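(* Every $\Phi_{(3)}$-superstrongly unstable ($\Phi_{(3)}$-SSU) Riemannian manifold $M$ is $p$-superstrongly unstable ($p$-SSU) for any $2\le p\le6$.
   Context: Let $M$ be an $m$-dimensional Riemannian manifold. $M$ is $\Phi_{(3)}$-SSU if there exists an isometric immersion of $M$ in some Euclidean space $\mathbb R^q$, with second fundamental form $B$, such that for every point $x\in M$ and every unit tangent vector $v\in T_xM$, $$F_{\Phi_{(3)},x}(v)=\sum_{i=1}^m\Big(6\langle B(v,e_i),B(v,e_i)\rangle_{\mathbb R^q}-\langle B(v,v),B(e_i,e_i)\rangle_{\mathbb R^q}\Big)<0,$$ where $\{e_1,\dots,e_m\}$ is a local orthonormal frame on $M$ near $x$. For $p\ge2$, $M$ is $p$-SSU if there exists an isometric immersion of $M$ in some $\mathbb R^q$, with second fundamental form $B$, such that for every $x\in M$ and every unit $v\in T_xM$, $$F_{p,x}(v)=(p-2)\langle B(v,v),B(v,v)\rangle_{\mathbb R^q}+\sum_{i=1}^m\Big(2\langle B(v,e_i),B(v,e_i)\rangle_{\mathbb R^q}-\langle B(v,v),B(e_i,e_i)\rangle_{\mathbb R^q}\Big)<0.$$ *)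

(* Defs.v *)
From HB Require Import structures.
From mathcomp Require Import all_boot all_order all_algebra.
From mathcomp Require Import all_classical all_reals all_analysis.

Set Implicit Arguments.
Unset Strict Implicit.
Unset Printing Implicit Defensive.

Import Order.TTheory GRing.Theory Num.Theory.
Import numFieldNormedType.Exports.

Local Open Scope classical_set_scope.
Local Open Scope ring_scope.

(** Euclidean space R^n is ['rV[R]_n]; its library norm is the sup norm, which
    is only used for topology and differentiability. The Euclidean inner product
    is [dot]. *)
Definition dot (R : realType) (n : nat) (u v : 'rV[R]_n) : R :=
  \sum_(k < n) u 0 k * v 0 k.

(** C^k and smooth maps on a set [A], meant for [A] open and [V] of finite
    dimension, where this is the usual notion. *)
Fixpoint Ck_on (R : realType) (V W : normedModType R) (k : nat) (A : set V)
    (f : V -> W) : Prop :=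
  match k with
  | 0 => forall x, A x -> {for x, continuous f}
  | k'.+1 => (forall x, A x -> differentiable f x) /\
             (forall v : V, Ck_on k' A ('D_v f))
  end.

Definition smooth_on (R : realType) (V W : normedModType R) (A : set V)
    (f : V -> W) : Prop :=
  forall k, Ck_on k A f.

(** [cinv] is only meaningful on the image of the chart. *)
Record chart (R : realType) (m : nat) (M : topologicalType) := Chart {
  cdom : set M ;
  cmap : M -> 'rV[R]_m ;
  cinv : 'rV[R]_m -> M ;
  cdom_open : open cdom ;
  cimg_open : open (cmap @` cdom) ;
  cmapK : forall x, cdom x -> cinv (cmap x) = x ;
  cmap_continuous : {within cdom, continuous cmap} ;
  cinv_continuous : {within cmap @` cdom, continuous cinv} }.

Definition transition (R : realType) (m : nat) (M : topologicalType)
    (c c' : chart R m M) : 'rV[R]_m -> 'rV[R]_m :=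
  cmap c' \o cinv c.

(** Tangent vectors at [x] are given by their coordinates in a chart [c] around
    [x]: the row vector [u] stands for [\sum_k u 0 k *: d/dx_k]; the change of
    coordinates from [c] to [c'] is the differential of [transition c c'].
    [gram c x] is the Gram matrix of the metric at [x] in the coordinate basis
    of [c]. *)
Record riemannian_manifold (R : realType) (m : nat) := RiemannianManifold {
  carrier :> topologicalType ;
  carrier_hausdorff : hausdorff_space carrier ;
  carrier_second_countable : @second_countable carrier ;
  atlas : set (chart R m carrier) ;
  atlas_cover : forall x : carrier, exists2 c, atlas c & cdom c x ;
  atlas_compatible : forall c c', atlas c -> atlas c' ->
    smooth_on (cmap c @` (cdom c `&` cdom c')) (transition c c') ;
  gram : chart R m carrier -> carrier -> 'M[R]_m ;
  gram_smooth : forall c, atlas c ->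
    smooth_on (cmap c @` cdom c) (gram c \o cinv c) ;
  gram_sym : forall c x, atlas c -> cdom c x -> (gram c x)^T = gram c x ;
  gram_posdef : forall c x, atlas c -> cdom c x ->
    forall u : 'rV[R]_m, u != 0 -> 0 < dot (u *m gram c x) u ;
  gram_compatible : forall c c' x, atlas c -> atlas c' ->
    cdom c x -> cdom c' x ->
    forall u v : 'rV[R]_m,
      dot (u *m gram c x) v =
      dot ('d (transition c c') (cmap c x) u *m gram c' x)
          ('d (transition c c') (cmap c x) v) }.

Section Immersions.
Context {R : realType} {m : nat} (M : riemannian_manifold R m).

Definition metric (c : chart R m M) (x : M) (u v : 'rV[R]_m) : R :=
  dot (u *m gram c x) v.

(** A smooth orthonormal frame on a neighborhood [U] of [x] inside the chart
    domain, given by its [c]-coordinates. *)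
Definition local_orthonormal_frame (c : chart R m M) (x : M)
    (e : 'I_m -> M -> 'rV[R]_m) : Prop :=
  exists U : set M,
    [/\ open U, U x, U `<=` cdom c,
        forall i, smooth_on (cmap c @` U) (e i \o cinv c)
      & forall y, U y -> forall i j, metric c y (e i y) (e j y) = (i == j)%:R].

Definition local_rep (q : nat) (f : M -> 'rV[R]_q) (c : chart R m M) :
    'rV[R]_m -> 'rV[R]_q :=
  f \o cinv c.

Definition isometric_immersion (q : nat) (f : M -> 'rV[R]_q) : Prop :=
  forall c, atlas c ->
    smooth_on (cmap c @` cdom c) (local_rep f c) /\
    forall x, cdom c x ->
      injective ('d (local_rep f c) (cmap c x)) /\
      forall u v : 'rV[R]_m,
        dot ('d (local_rep f c) (cmap c x) u)
            ('d (local_rep f c) (cmap c x) v) = metric c x u v.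

(** Orthogonal projection of R^q onto the normal space at [x]. The tangent space
    of the immersion is the row space of the Jacobian [J], and its orthogonal
    complement is [kermx J^T]. *)
Definition normal_proj (q : nat) (f : M -> 'rV[R]_q) (c : chart R m M) (x : M)
    (w : 'rV[R]_q) : 'rV[R]_q :=
  let J := 'J (local_rep f c) (cmap c x) in
  w *m proj_mx (kermx J^T) <<J>>%MS.

(** B(u, v) is the normal component of the flat derivative along [u] of the
    vector field df(V), where V extends [v] with constant [c]-coordinates. *)
Definition second_fundamental_form (q : nat) (f : M -> 'rV[R]_q)
    (c : chart R m M) (x : M) (u v : 'rV[R]_m) : 'rV[R]_q :=
  normal_proj f c x ('D_u ('D_v (local_rep f c)) (cmap c x)).

Definition F_Phi3 (q : nat) (f : M -> 'rV[R]_q) (c : chart R m M) (x : M)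
    (e : 'I_m -> M -> 'rV[R]_m) (v : 'rV[R]_m) : R :=
  let B := second_fundamental_form f c x in
  \sum_(i < m) (6 * dot (B v (e i x)) (B v (e i x))
                - dot (B v v) (B (e i x) (e i x))).

Definition F_p (p : R) (q : nat) (f : M -> 'rV[R]_q) (c : chart R m M) (x : M)
    (e : 'I_m -> M -> 'rV[R]_m) (v : 'rV[R]_m) : R :=
  let B := second_fundamental_form f c x in
  (p - 2) * dot (B v v) (B v v)
  + \sum_(i < m) (2 * dot (B v (e i x)) (B v (e i x))
                  - dot (B v v) (B (e i x) (e i x))).

Definition Phi3_SSU : Prop :=
  exists (q : nat) (f : M -> 'rV[R]_q), isometric_immersion f /\
    forall (c : chart R m M) (x : M) (e : 'I_m -> M -> 'rV[R]_m)
      (v : 'rV[R]_m),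
      atlas c -> cdom c x -> local_orthonormal_frame c x e ->
      metric c x v v = 1 -> F_Phi3 f c x e v < 0.

Definition p_SSU (p : R) : Prop :=
  exists (q : nat) (f : M -> 'rV[R]_q), isometric_immersion f /\
    forall (c : chart R m M) (x : M) (e : 'I_m -> M -> 'rV[R]_m)
      (v : 'rV[R]_m),
      atlas c -> cdom c x -> local_orthonormal_frame c x e ->
      metric c x v v = 1 -> F_p p f c x e v < 0.

End Immersions.

(* Main.v *)
Require Import Defs.
From mathcomp Require Import all_boot all_order all_algebra.
From mathcomp Require Import all_classical all_reals all_analysis.
From mathcomp Require Import ring lra.

Import Order.TTheory GRing.Theory Num.Theory.
Import numFieldNormedType.Exports.

Local Open Scope ring_scope.

(** The isometric immersion that witnesses the first instability witnesses the
    second one as well: for each unit vector v the functional F_p is bounded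
    above by F_Phi3. The trace terms - <B(v,v), B(e_i,e_i)> are common to both,
    so the difference F_Phi3 - F_p is

      4 \sum_i |B(v,e_i)|^2 - (p - 2) |B(v,v)|^2.

    Since p - 2 <= 4, it is enough that |B(v,v)|^2 <= \sum_i |B(v,e_i)|^2
    ([dot_second_fundamental_form_le]). To see this, expand v in the
    orthonormal frame as \sum_i a_i e_i, with \sum_i a_i^2 = 1
    ([orthonormal_expansion], [orthonormal_parseval]). Linearity of B in its
    second argument ([second_fundamental_form_sumr]) gives
    B(v,v) = \sum_i a_i B(v,e_i), and the bound is then an instance of the
    Cauchy-Schwarz inequality ([dot_lincomb_le]). *)

(** * Euclidean inner product and orthonormal frames *)

Lemma dotE (R : realType) (n : nat) (u v : 'rV[R]_n) :
  dot u v = (u *m v^T) 0 0.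
Proof. by rewrite mxE; apply: eq_bigr => k _; rewrite mxE. Qed.

Lemma dot_sumr (R : realType) (n k : nat) (u : 'rV[R]_n) (a : 'I_k -> R)
    (w : 'I_k -> 'rV[R]_n) :
  dot u (\sum_i a i *: w i) = \sum_i a i * dot u (w i).
Proof.
rewrite dotE linear_sum mulmx_sumr summxE; apply: eq_bigr => i _.
by rewrite linearZ /= -scalemxAr mxE dotE.
Qed.

(** Expand the nonnegative number \sum_i |w_i - a_i w|^2, where
    w = \sum_i a_i w_i: the cross terms add up to - 2 |w|^2 and, as
    \sum_i a_i^2 = 1, the last ones to |w|^2. *)
Lemma dot_lincomb_le (R : realType) (n k : nat) (a : 'I_k -> R)
    (w : 'I_k -> 'rV[R]_n) :
  \sum_i a i ^+ 2 = 1 ->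
  dot (\sum_i a i *: w i) (\sum_i a i *: w i) <= \sum_i dot (w i) (w i).
Proof.
move=> a1; set z := \sum_i a i *: w i.
have sq_ge0 : 0 <= \sum_i dot (w i - a i *: z) (w i - a i *: z).
  by do 2!(apply: sumr_ge0 => ? _); rewrite -expr2 sqr_ge0.
have sqE i : dot (w i - a i *: z) (w i - a i *: z) =
    dot (w i) (w i) - 2 * (a i * dot z (w i)) + a i ^+ 2 * dot z z.
  rewrite /dot !mulr_sumr -sumrN -!big_split /=.
  by apply: eq_bigr => j _; rewrite !mxE; ring.
move: sq_ge0; under eq_bigr do rewrite sqE.
rewrite !big_split /= sumrN -mulr_sumr -dot_sumr -/z -mulr_suml a1.
lra.
Qed.

(** Orthonormality says E G E^T = 1 for the square matrix E of the frame, so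
    G E^T is also a left inverse: G E^T E = 1. Applied to v on the left, this
    is the expansion of v, because the entries of v G E^T are the inner products
    of v with the frame. *)
Lemma orthonormal_expansion (R : realType) (n : nat) (G : 'M[R]_n)
    (e : 'I_n -> 'rV[R]_n) (v : 'rV[R]_n) :
  (forall i j, dot (e i *m G) (e j) = (i == j)%:R) ->
  v = \sum_i dot (v *m G) (e i) *: e i.
Proof.
move=> eG; pose E := \matrix_i e i.
have EGE : E *m (G *m E^T) = 1%:M.
  apply/matrixP => i j; rewrite mulmxA [RHS]mxE -(eG i j) !mxE.
  apply: eq_bigr => k _; rewrite !mxE; congr (_ * _).
  by apply: eq_bigr => l _; rewrite mxE.
rewrite -[LHS]mulmx1 -(mulmx1C EGE) !mulmxA mulmx_sum_row.
apply: eq_bigr => i _; rewrite rowK dotE; congr (_ *: _).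
by rewrite !mxE; apply: eq_bigr => k _; rewrite !mxE.
Qed.

Lemma orthonormal_parseval (R : realType) (n : nat) (G : 'M[R]_n)
    (e : 'I_n -> 'rV[R]_n) (v : 'rV[R]_n) :
  (forall i j, dot (e i *m G) (e j) = (i == j)%:R) ->
  \sum_i dot (v *m G) (e i) ^+ 2 = dot (v *m G) v.
Proof.
move=> eG; rewrite {3}(orthonormal_expansion _ _ G e v eG) dot_sumr.
by apply: eq_bigr => i _; rewrite expr2.
Qed.

(** * Linearity of the second fundamental form *)

(** A first derivative is linear in its direction at each point where f is
    differentiable. Openness of A makes this an identity of functions near x,
    which can be differentiated once more. *)
Lemma derive2_sum_dir (R : realType) (V W : normedModType R) (A : set V)
    (f : V -> W) (x u : V) (n : nat) (a : 'I_n -> R) (w : 'I_n -> V) :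
  open A -> smooth_on A f -> A x ->
  'D_u ('D_(\sum_i a i *: w i) f) x = \sum_i a i *: 'D_u ('D_(w i) f) x.
Proof.
move=> oA fA Ax; have [df _] := fA 1%N.
have d2f v : derivable ('D_v f) x u.
  by apply: diff_derivable; have [_ /(_ v)[d2 _]] := fA 2%N; exact: d2.
rewrite (@near_eq_derive _ _ _ _ (\sum_i a i \*: 'D_(w i) f)).
  rewrite derive_sum; last by move=> i; exact: derivableZ.
  by apply: eq_bigr => i _; rewrite deriveZ.
apply: filterS (open_nbhs_nbhs (conj oA Ax)) => y Ay.
rewrite deriveE; last exact: df.
rewrite linear_sum fct_sumE; apply: eq_bigr => i _.
by rewrite linearZ /= deriveE//; exact: df.
Qed.

Lemma second_fundamental_form_sumr (R : realType) (m q : nat)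
    (M : riemannian_manifold R m) (f : M -> 'rV[R]_q) (c : chart R m M) (x : M)
    (u : 'rV[R]_m) (n : nat) (a : 'I_n -> R) (w : 'I_n -> 'rV[R]_m) :
  isometric_immersion f -> atlas c -> cdom c x ->
  second_fundamental_form f c x u (\sum_i a i *: w i) =
  \sum_i a i *: second_fundamental_form f c x u (w i).
Proof.
move=> fi cA cx; have [fs _] := fi _ cA.
rewrite /second_fundamental_form.
rewrite (derive2_sum_dir _ _ _ _ _ _ _ _ _ _ (@cimg_open _ _ _ c) fs); last first.
  by exists x.
by rewrite /normal_proj mulmx_suml; apply: eq_bigr => i _; rewrite -scalemxAl.
Qed.

Lemma dot_second_fundamental_form_le (R : realType) (m q : nat)
    (M : riemannian_manifold R m) (f : M -> 'rV[R]_q) (c : chart R m M) (x : M)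
    (e : 'I_m -> M -> 'rV[R]_m) (u v : 'rV[R]_m) :
  isometric_immersion f -> atlas c -> cdom c x ->
  local_orthonormal_frame c x e -> metric c x v v = 1 ->
  dot (second_fundamental_form f c x u v) (second_fundamental_form f c x u v)
  <= \sum_i dot (second_fundamental_form f c x u (e i x))
                (second_fundamental_form f c x u (e i x)).
Proof.
move=> fi cA cx [U [_ Ux _ _ /(_ x Ux) ex]] v1.
rewrite {1 2}(orthonormal_expansion _ _ _ (e ^~ x) v ex).
rewrite (second_fundamental_form_sumr _ _ _ _ _ _ _ _ _ _ _ fi cA cx).
apply: dot_lincomb_le.
by rewrite (orthonormal_parseval _ _ _ (e ^~ x) v ex).
Qed.

(** * Comparison of the two instability functionals *)

(** Used with b = |B(v,v)|^2, s_i = |B(v,e_i)|^2 and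
    t_i = <B(v,v), B(e_i,e_i)>; the bound p <= 6 enters as p - 2 <= 6 - 2. *)
Lemma instability_sum_le (R : realType) (m : nat) (p b : R) (s t : 'I_m -> R) :
  p <= 6 -> 0 <= b -> b <= \sum_i s i ->
  (p - 2) * b + \sum_i (2 * s i - t i) <= \sum_i (6 * s i - t i).
Proof.
move=> p6 b0 bs; rewrite !big_split /= -!mulr_sumr addrA lerD2r.
have : (p - 2) * b <= 4 * b by apply: ler_wpM2r => //; lra.
lra.
Qed.

Theorem theorem11p13 (R : realType) (m : nat) (M : riemannian_manifold R m)
    (p : R) (hp2 : 2 <= p) (hp6 : p <= 6) (hM : Phi3_SSU M) : p_SSU M p.
Proof.
have [q [f [fi neg]]] := hM; exists q, f; split=> // c x e v cA cx ex v1.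
apply: le_lt_trans (neg c x e v cA cx ex v1).
apply: instability_sum_le => //.
  by apply: sumr_ge0 => k _; rewrite -expr2 sqr_ge0.
exact: (dot_second_fundamental_form_le _ _ _ _ f c x e v v fi cA cx ex v1).
Qed.
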